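(* Let $G$ be a finite group such that its same-order type $\tau_e(G)$ is an arithmetic progression. Then $|\tau_e(G)|\leq 4$.
   Context: For a finite group $G$, let $o(x)$ denote the order of $x\in G$, and define the equivalence relation $x\sim y \iff o(x)=o(y)$ on $G$. The same-order type $\tau_e(G)$ is the set of the sizes of the equivalence classes of $\sim$; that is, $\tau_e(G)$ is the set of positive integers of the form $|\{x\in G : o(x)=n\}|$, where $n$ runs over the orders of elements of $G$. It is a set, so equal sizes are counted once. A finite set of integers is called an arithmetic progression if its elements, listed in increasing order, form an arithmetic progression, i.e. consecutive elements differ by a constant $r$ (the ratio); sets with one or two elements count trivially as arithmetic progressions. *)

(* Defs.v *)
From mathcomp Require Import all_boot all_order all_fingroup.
From mathcomp Require Import finmap.

Set Implicit Arguments.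
Unset Strict Implicit.
Unset Printing Implicit Defensive.

Definition same_order (gT : finGroupType) : rel gT :=
  [rel x y | #[x]%g == #[y]%g].

Definition same_order_type (gT : finGroupType) (G : {group gT}) : {fset nat} :=
  [fset #|pred_of_set C| | C in equivalence_partition (@same_order gT) G]%fset.

(* As the elements are listed in increasing order, the ratio r is a natural
   number. For at most two elements the condition always holds. *)
Definition arithmetic_progression (A : {fset nat}) : Prop :=
  exists r : nat, sorted [rel a b | b == a + r] (sort leq A).

(* Main.v *)
Require Import Defs.
From mathcomp Require Import all_boot all_order all_fingroup.
From mathcomp Require Import finmap.
From mathcomp Require Import cyclic zify.

(** The only odd members of the same-order type are 1, the size of the class
    of the identity, and possibly the number of involutions: for [n > 2] the
    elements of order [n] fall into pairs [{x, x^-1}], so their number is even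
    ([odd_same_order_type]).

    As the least member of the type is 1, an arithmetic progression with five
    or more members starts with [1, 1 + r, 1 + 2r, 1 + 3r, 1 + 4r].  Both
    [1 + 2r] and [1 + 4r] are odd and distinct from 1, so both must be the
    number of involutions, although they differ. *)

Set Implicit Arguments.
Unset Strict Implicit.
Unset Printing Implicit Defensive.

Local Open Scope group_scope.

Lemma same_order_typeP (gT : finGroupType) (G : {group gT}) (m : nat) :
  reflect (exists2 x, x \in G & m = #|[set y in G | #[x] == #[y]]|)
          (m \in same_order_type G).
Proof.
apply: (iffP (imfsetP _ _ _ _)) => [[C /= /imsetP[x Gx ->] ->] | [x Gx ->]].
  by exists x.
by exists [set y in G | #[x] == #[y]] => //=; apply: imset_f.
Qed.

Lemma same_order_type_gt0 (gT : finGroupType) (G : {group gT}) (m : nat) :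
  m \in same_order_type G -> 0 < m.
Proof.
case/same_order_typeP=> x Gx ->; apply/card_gt0P; exists x.
by rewrite inE Gx eqxx.
Qed.

Lemma card_order1 (gT : finGroupType) (G : {group gT}) :
  #|[set y in G | 1%N == #[y]]| = 1%N.
Proof.
rewrite -[RHS](cards1 (1 : gT)); apply: eq_card => y.
rewrite !inE [1%N == _]eq_sym order_eq1.
by case: eqP => [-> | _]; rewrite ?group1 ?andbF.
Qed.

Lemma same_order_type1 (gT : finGroupType) (G : {group gT}) :
  1%N \in same_order_type G.
Proof.
apply/same_order_typeP; exists 1; first exact: group1.
by rewrite order1 card_order1.
Qed.

(** The orbits of inversion on the elements of order [n] all have exactly two
    points, since [x = x^-1] would force the order of [x] to divide 2. *)
Lemma even_card_order (gT : finGroupType) (G : {group gT}) (n : nat) :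
  2 < n -> ~~ odd #|[set y in G | n == #[y]]|.
Proof.
move=> n_gt2; set A := [set _ in _ | _].
have sA2 : A \subset order_set (@inv gT) 2.
  apply/subsetP=> y; rewrite inE => /andP[_ /eqP oy]; rewrite inE.
  have y_neqV : y != y^-1.
    apply: contraTneq n_gt2 => yV; rewrite -leqNgt oy dvdn_leq // order_dvdn.
    by rewrite expgS expg1 {2}yV mulgV.
  apply/eqP/(@order_cycle _ _ [:: y; y^-1]); last exact: mem_head.
    by rewrite /= invgK !eqxx.
  by rewrite /= inE y_neqV.
have clA : fclosed (@inv gT) A.
  by move=> x _ /eqP <-; rewrite !inE groupV orderV.
by rewrite -(fcard_order_set invg_inj sA2 clA) oddM andbF.
Qed.

Lemma odd_same_order_type (gT : finGroupType) (G : {group gT}) (m : nat) :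
    m \in same_order_type G -> odd m -> m != 1%N ->
  m = #|[set y in G | 2 == #[y]]|.
Proof.
case/same_order_typeP=> x _ -> odd_m m_neq1.
have [|x_le2] := ltnP 2 #[x]; first by move/(even_card_order G)/negP.
have x_neq1 : #[x] != 1%N.
  by apply: contraNneq m_neq1 => ->; rewrite card_order1.
by have -> : #[x] = 2 by move: (order_gt0 x) x_neq1 x_le2; lia.
Qed.

Theorem proposition2p2 (gT : finGroupType) (G : {group gT})
    (hG : arithmetic_progression (same_order_type G)) :
  (#|` same_order_type G|%fset <= 4)%N.
Proof.
case: hG => r ap_s.
have mem_s := mem_sort leq (same_order_type G).
have sorted_s := sort_sorted leq_total (same_order_type G).
have uniq_s := sort_uniq leq (same_order_type G).
rewrite fset_uniq in uniq_s.
rewrite -(size_sort leq).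
move: (sort _ _) => s in ap_s mem_s sorted_s uniq_s *.
case: s => [|a [|b [|c [|d [|e s]]]]] // in ap_s mem_s sorted_s uniq_s *.
have a1 : a = 1%N.
  have a_gt0 : 0 < a.
    by apply: (@same_order_type_gt0 _ G); rewrite -mem_s mem_head.
  have : 1%N \in [:: a, b, c, d, e & s] by rewrite mem_s same_order_type1.
  rewrite inE => /predU1P[// | s1].
  have /allP/(_ _ s1) := order_path_min leq_trans sorted_s.
  by move=> a_le1; apply/eqP; rewrite eqn_leq a_le1.
case/and5P: ap_s => /eqP eb /eqP ec /eqP ed /eqP ee _.
have r_gt0 : 0 < r.
  by move: uniq_s; rewrite /= inE; case: eqP => //; lia.
have Tc : c \in same_order_type G by rewrite -mem_s !inE eqxx !orbT.
have Te : e \in same_order_type G by rewrite -mem_s !inE eqxx !orbT.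
have := odd_same_order_type Tc; have := odd_same_order_type Te.
by move: #|_| => k; lia.
Qed.
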